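(* The reduced equations of motion of the $n$-dimensional Veselova system on $T^*\mathrm{S}^{n-1}$ are $$\dot q=C\left[p-\left(\frac{p\cdot Cq}{q\cdot Cq}\right)q\right],\qquad \dot p=-2H(q,p)\,q,$$ where $C=C(q)=\left(\mathbb{J}+(q\cdot\mathbb{J}q)\mathrm{Id}_n\right)^{-1}$ and $$H(q,p)=\frac12\left(p\cdot Cp-\frac{(p\cdot Cq)^2}{q\cdot Cq}\right)$$ is the energy integral. Furthermore, this system is invariant under the action of $G_R$ on $T^*\mathrm{S}^{n-1}$ given by $h\cdot(q,p)=(hq,hp)$.
   Context: Let $n\ge 2$. $\mathfrak{so}(n)$ is the space of real skew-symmetric $n\times n$ matrices with pairing $\langle\Lambda,\Omega\rangle=\tfrac12\mathrm{tr}(\Lambda^T\Omega)$; $a\wedge b=ab^T-ba^T$ for $a,b\in\mathbb{R}^n$; $\cdot$ is the Euclidean inner product. The mass tensor is $\mathbb{J}=\mathrm{diag}[J_1,\dots,J_n]$ with all $J_i>0$, and $\mathbb{I}(\Omega)=\mathbb{J}\Omega+\Omega\mathbb{J}$. $G_R=\{h\in\mathrm{O}(n): h\mathbb{J}h^{-1}=\mathbb{J}\}$. The $n$-dimensional Veselova system: let $e_1,\dots,e_n$ be the standard orthonormal basis of space, $e_1$ being the distinguished axis. For $g\in\mathrm{O}(n)$ put $q=g^{-1}e_1$, $E_r=g^{-1}e_r$. The phase space is $D=\{(g,\Omega)\in\mathrm{O}(n)\times\mathfrak{so}(n):\Omega=q\wedge v\text{ for some }v\in\mathbb{R}^n\}$.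 A solution is a curve in $D$ with $\dot g=g\Omega$ and $\frac{d}{dt}\mathbb{I}(\Omega)=[\mathbb{I}(\Omega),\Omega]+\sum_{2\le r<s\le n}\lambda_{rs}E_r\wedge E_s$, the multipliers $\lambda_{rs}$ being uniquely determined by the requirement that the constraints $\langle E_r\wedge E_s,\Omega\rangle=0$ ($2\le r<s\le n$) be preserved. The energy is $\tfrac12\langle\mathbb{I}(\Omega),\Omega\rangle$. Let $G_L\cong\mathrm{O}(n-1)$ be the subgroup of $\mathrm{O}(n)$ fixing $e_1$, acting on $D$ by $A\cdot(g,\Omega)=(Ag,\Omega)$. Realise $T^*\mathrm{S}^{n-1}=\{(q,p)\in\mathbb{R}^n\times\mathbb{R}^n:\|q\|=1,\ q\cdot p=0\}$. The map $D\to T^*\mathrm{S}^{n-1}$, $(g,\Omega)\mapsto(q,p)$ with $q=g^{-1}e_1$, $p=-\mathbb{I}(\Omega)q$, induces an identification $D/G_L\cong T^*\mathrm{S}^{n-1}$, and the reduced equations of motion are the equations satisfied by the image $(q(t),p(t))$ of a solution in $D$. ''Energy integral'' means that $H(q,p)$ equals the energy $\tfrac12\langle\mathbb{I}(\Omega),\Omega\rangle$ under this identification. *)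

(* Defs.v *)
From HB Require Import structures.
From mathcomp Require Export all_boot all_order all_algebra.
From mathcomp Require Export all_classical all_reals all_analysis.
Export Order.TTheory GRing.Theory Num.Theory.
Export numFieldNormedType.Exports.

Set Implicit Arguments.
Unset Strict Implicit.
Unset Printing Implicit Defensive.

Local Open Scope classical_set_scope.
Local Open Scope ring_scope.

Section Veselova.
Context {R : realType} {m : nat}.

(* The dimension is [m.+1]; the axes e_1, ..., e_n of space are [axis 0], ...,
   [axis ord_max], so that e_1 is [axis 0]. *)
Local Notation vec := 'cV[R]_m.+1.
Local Notation mat := 'M[R]_m.+1.

Definition axis (r : 'I_m.+1) : vec := delta_mx r 0.

Definition dot (a b : vec) : R := (a^T *m b) 0 0.

(* The norm [`|a|] of the library on matrices is the sup norm, hence this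
   Euclidean one. *)
Definition enorm (a : vec) : R := Num.sqrt (dot a a).

Definition wedge (a b : vec) : mat := a *m b^T - b *m a^T.

Definition pairing (A B : mat) : R := 2^-1 * \tr (A^T *m B).

Definition commutator (A B : mat) : mat := A *m B - B *m A.

Definition is_orthogonal (g : mat) : Prop := g^T *m g = 1%:M.

Definition is_skew_mx (A : mat) : Prop := A^T = - A.

Definition body_axis (g : mat) (r : 'I_m.+1) : vec := invmx g *m axis r.

Definition phase_space (g Om : mat) : Prop :=
  [/\ is_orthogonal g, is_skew_mx Om & exists v : vec, Om = wedge (body_axis g 0) v].

Definition GL (A : mat) : Prop := is_orthogonal A /\ A *m axis 0 = axis 0.

(* T^*S^{n-1} realised in R^n x R^n. *)
Definition cotangent_sphere (q p : vec) : Prop := enorm q = 1 /\ dot q p = 0.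

(* [J] is the row of diagonal entries of the mass tensor. *)
Variable J : 'rV[R]_m.+1.

Definition inertia (Om : mat) : mat := diag_mx J *m Om + Om *m diag_mx J.

Definition energy (Om : mat) : R := 2^-1 * pairing (inertia Om) Om.

Definition GR (h : mat) : Prop :=
  is_orthogonal h /\ h *m diag_mx J *m invmx h = diag_mx J.

Definition reaction (g lam : mat) : mat :=
  \sum_(r < m.+1 | (0 < r)%N) \sum_(s < m.+1 | (r < s)%N)
    lam r s *: wedge (body_axis g r) (body_axis g s).

(* Curves are total functions of which only the restriction to the open
   interval [I] matters. *)
Definition kinematic_curve (I : set R) (g Om : R -> mat) : Prop :=
  forall t, I t ->
    phase_space (g t) (Om t) /\ is_derive t 1 g (g t *m Om t).

Definition veselova_solution (I : set R) (g Om : R -> mat) : Prop :=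
  kinematic_curve I g Om /\
  forall t, I t -> exists lam : mat,
    is_derive t 1 (fun s => inertia (Om s))
      (commutator (inertia (Om t)) (Om t) + reaction (g t) lam).

Definition proj_q (g Om : mat) : vec := body_axis g 0.
Definition proj_p (g Om : mat) : vec := - (inertia Om *m body_axis g 0).

Definition Cmx_inv (q : vec) : mat := diag_mx J + (dot q (diag_mx J *m q))%:M.
Definition Cmx (q : vec) : mat := invmx (Cmx_inv q).

Definition hamiltonian (q p : vec) : R :=
  2^-1 * (dot p (Cmx q *m p) - dot p (Cmx q *m q) ^+ 2 / dot q (Cmx q *m q)).

Definition qdot (q p : vec) : vec :=
  Cmx q *m (p - (dot p (Cmx q *m q) / dot q (Cmx q *m q)) *: q).

Definition pdot (q p : vec) : vec := (- 2 * hamiltonian q p) *: q.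

Definition reduced_solution (I : set R) (q p : R -> vec) : Prop :=
  forall t, I t ->
    [/\ cotangent_sphere (q t) (p t),
        is_derive t 1 q (qdot (q t) (p t)) &
        is_derive t 1 p (pdot (q t) (p t))].

(* The map (g, Om) |-> (q, p) is onto T^*S^{n-1} and its fibres are the orbits
   of A.(g, Om) = (A g, Om), for A in G_L. *)
Definition induces_identification : Prop :=
  [/\ forall g Om, phase_space g Om ->
        cotangent_sphere (proj_q g Om) (proj_p g Om),
      forall q p, cotangent_sphere q p ->
        exists g Om, [/\ phase_space g Om, proj_q g Om = q & proj_p g Om = p] &
      forall g Om g' Om', phase_space g Om -> phase_space g' Om' ->
        (proj_q g Om = proj_q g' Om' /\ proj_p g Om = proj_p g' Om') <->
        (exists A, [/\ GL A, g' = A *m g & Om' = Om])].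

End Veselova.

(* Main.v *)
Require Import Defs.
From mathcomp Require Import ring.

(** Everything is expressed through the Poisson vector [q] and the vector
    [w = - Om q].  On the phase space [q] is a unit vector, [w] is orthogonal to
    [q] and [Om = q /\ w], so that [(q, w)] is the same information as
    [(q, Om)].  With [D] the mass tensor and [C] the matrix [Cmx J q], the
    momentum is
      [p = - I(Om) q = C^-1 w - (w . D q) q]   (lemma [inertia_wedge]).
    Applying [C] and pairing with [q] gives [p . C q = - (w . D q) (q . C q)],
    whence [C (p - ((p . C q) / (q . C q)) q) = w]: the field [qdot] inverts the
    map [w |-> p] ([qdot_momentum] and [momentum_qdot]).  All static claims
    follow.  The pair [(q, p)] determines [Om], and [g] is determined by [q] up
    to left multiplication by the stabiliser of the distinguished axis; a
    reflection carrying [q] to that axis shows that every [(q, p)] is reached.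
    The energy is [(p . w) / 2], which is the Hamiltonian by [hamiltonianE].
    An element of [G_R] commutes with [D], hence with [C].

    For the dynamics, [q = g^T e_1] gives [q' = - Om q = w] from the kinematics
    alone.  If the inertia [M = I(Om)] has derivative [X], then
      [p' = - 2 H q - (X - [M, Om]) q]   (lemma [is_derive_proj_p]),
    because [Om M q = - Om p = - (w . p) q].  The reaction is a combination of
    the [E_r /\ E_s] with [E_r] and [E_s] orthogonal to [q], so it annihilates
    [q]: this is the reduced equation.  Conversely the reduced equation for [p]
    says that the skew matrix [X - [M, Om]] annihilates [q], and such a matrix is
    a combination of those same [E_r /\ E_s] ([reaction_of_skew]).
    In this direction the existence of [X] has to be proved: [Om] is
    differentiable because it equals [q /\ qdot(q, p)], and [C] is a diagonal
    matrix whose entries are smooth in [q]. *)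

Set Implicit Arguments.
Unset Strict Implicit.
Unset Printing Implicit Defensive.

Local Open Scope classical_set_scope.
Local Open Scope ring_scope.

(** * Inner product, wedges and skew matrices *)

Section LinearAlgebra.
Context {R : realType} {m : nat}.
Implicit Types (a b c q w p : 'cV[R]_m.+1) (A B g : 'M[R]_m.+1) (k : R).

Lemma dotE a b : dot a b = \sum_i a i 0 * b i 0.
Proof. by rewrite /dot mxE; apply: eq_bigr => i _; rewrite mxE. Qed.

Lemma dotC a b : dot a b = dot b a.
Proof. by rewrite !dotE; apply: eq_bigr => i _; rewrite mulrC. Qed.

Lemma dotDr a b c : dot a (b + c) = dot a b + dot a c.
Proof. by rewrite /dot mulmxDr mxE. Qed.

Lemma dotNr a b : dot a (- b) = - dot a b.
Proof. by rewrite /dot mulmxN mxE. Qed.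

Lemma dotZr a k b : dot a (k *: b) = k * dot a b.
Proof. by rewrite /dot -scalemxAr mxE. Qed.

Lemma dotBr a b c : dot a (b - c) = dot a b - dot a c.
Proof. by rewrite dotDr dotNr. Qed.

Lemma dotDl a b c : dot (a + b) c = dot a c + dot b c.
Proof. by rewrite dotC dotDr !(dotC c). Qed.

Lemma dotNl a b : dot (- a) b = - dot a b.
Proof. by rewrite dotC dotNr dotC. Qed.

Lemma dotBl a b c : dot (a - b) c = dot a c - dot b c.
Proof. by rewrite dotDl dotNl. Qed.

Lemma dot_mulmxl A a b : dot (A *m a) b = dot a (A^T *m b).
Proof. by rewrite /dot trmx_mul mulmxA. Qed.

(** Lets an inner product met inside a longer matrix product be pulled out as a
    scalar. *)
Lemma dot_scalar a b : a^T *m b = (dot a b)%:M.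
Proof. by rewrite [LHS]mx11_scalar. Qed.

Lemma dot_ge0 a : 0 <= dot a a.
Proof. by rewrite dotE sumr_ge0// => i _; rewrite -expr2 sqr_ge0. Qed.

Lemma dot_eq0 a : dot a a = 0 -> a = 0.
Proof.
rewrite dotE => /psumr_eq0P a0; apply/matrixP => i j; rewrite ord1 mxE.
by apply/eqP; rewrite -sqrf_eq0 expr2 a0// => k _; rewrite -expr2 sqr_ge0.
Qed.

Lemma enorm1 a : enorm a = 1 <-> dot a a = 1.
Proof.
split=> [a1|]; last by rewrite /enorm => ->; rewrite sqrtr1.
by rewrite -(sqr_sqrtr (dot_ge0 a)) -/(enorm a) a1 expr1n.
Qed.

Lemma wedge_mulmx a b c : wedge a b *m c = dot b c *: a - dot a c *: b.
Proof.
by rewrite mulmxBl -!mulmxA !dot_scalar !mul_mx_scalar.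
Qed.

Lemma wedge_skew a b : is_skew_mx (wedge a b).
Proof.
by rewrite /is_skew_mx /wedge linearB /= !trmx_mul !trmxK opprB.
Qed.

Lemma wedge_conj A a b : wedge (A *m a) (A *m b) = A *m wedge a b *m A^T.
Proof. by rewrite /wedge !trmx_mul mulmxBr mulmxBl !mulmxA. Qed.

Lemma dot_skew A a : is_skew_mx A -> dot a (A *m a) = 0.
Proof.
move=> skA; have : dot a (A *m a) = - dot a (A *m a).
  by rewrite {1}dotC dot_mulmxl skA mulNmx dotNr.
by move/eqP; rewrite -addr_eq0 -mulr2n mulrn_eq0 /= => /eqP.
Qed.

Lemma commutator_skew A B :
  is_skew_mx A -> is_skew_mx B -> is_skew_mx (commutator A B).
Proof.
move=> skA skB; rewrite /is_skew_mx /commutator linearB /= !trmx_mul skA skB.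
by rewrite !mulNmx !mulmxN !opprK opprB.
Qed.

Lemma mxtrace_outer a b : \tr (a *m b^T) = dot b a.
Proof. by rewrite mxtrace_mulC dot_scalar mxtrace_scalar mulr1n. Qed.

Lemma pairing_skew_wedge A a b :
  is_skew_mx A -> pairing A (wedge a b) = - dot (A *m a) b.
Proof.
move=> skA; rewrite /pairing /wedge mulmxBr linearB /= !mulmxA !mxtrace_outer.
rewrite -[dot a _]dot_mulmxl skA mulNmx dotNr (dotC b).
by field.
Qed.

Lemma invmx_orthogonal g : is_orthogonal g -> invmx g = g^T.
Proof.
move=> og; have [_ ug] := mulmx1_unit og.
by rewrite -[invmx g]mul1mx -og mulmxK.
Qed.

Lemma orthogonal_mulmxT g : is_orthogonal g -> g *m g^T = 1%:M.
Proof. exact: mulmx1C. Qed.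

Lemma body_axis_orthogonal g r : is_orthogonal g -> body_axis g r = g^T *m axis r.
Proof. by move=> og; rewrite /body_axis invmx_orthogonal. Qed.

Lemma dot_orthogonal g a b : is_orthogonal g -> dot (g *m a) (g *m b) = dot a b.
Proof. by move=> og; rewrite dot_mulmxl mulmxA og mul1mx. Qed.

Lemma orthogonal_tr g : is_orthogonal g -> is_orthogonal g^T.
Proof. by move=> og; rewrite /is_orthogonal trmxK orthogonal_mulmxT. Qed.

Lemma dot_axis (r s : 'I_m.+1) : dot (axis r) (axis s) = (r == s)%:R :> R.
Proof.
rewrite dotE (bigD1 r)//= !mxE !eqxx mul1r andbT big1 ?addr0// => i ir.
by rewrite !mxE (negPf ir) mul0r.
Qed.

Lemma dot_body_axis g r s :
  is_orthogonal g -> dot (body_axis g r) (body_axis g s) = (r == s)%:R.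
Proof.
move=> og; rewrite !body_axis_orthogonal// dot_orthogonal ?dot_axis//.
exact: orthogonal_tr.
Qed.

(** For [u = 0] the coefficient [2 / dot u u] is [0] and the matrix is the
    identity, so [reflection_sub] needs no case distinction on [a = b]. *)
Definition reflection (u : 'cV[R]_m.+1) : 'M[R]_m.+1 :=
  1%:M - (2 / dot u u) *: (u *m u^T).

(** With [P = u u^T] and [k = 2 / (u . u)] one has [P^2 = (u . u) P], so the square
    of the symmetric matrix [1 - k P] is [1 - 2 k P + k^2 (u . u) P = 1]. *)
Lemma reflection_orthogonal (u : 'cV[R]_m.+1) : is_orthogonal (reflection u).
Proof.
rewrite /reflection; set k := 2 / _.
have kk : k * k * dot u u = 2 * k.
  rewrite /k; have [->|u0] := eqVneq (dot u u) 0; first by rewrite invr0; ring.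
  by field.
have PT : (u *m u^T)^T = u *m u^T by rewrite trmx_mul trmxK.
have PP : u *m u^T *m (u *m u^T) = dot u u *: (u *m u^T).
  by rewrite mulmxA -[u *m u^T *m u]mulmxA dot_scalar mul_mx_scalar scalemxAl.
rewrite /is_orthogonal [(_ - _)^T]linearB /= trmx1 linearZ /= PT.
rewrite mulmxBr mulmx1 mulmxBl mul1mx -scalemxAl -scalemxAr PP !scalerA kk.
by rewrite mulr_natl mulr2n scalerDl opprB addrK subrK.
Qed.

(** Since [a] and [b] have the same length, [u . a = (u . u) / 2] for [u = a - b],
    so the component of [a] along [u] that is removed is exactly [u]. *)
Lemma reflection_sub a b : dot a a = dot b b -> reflection (a - b) *m a = b.
Proof.
move=> ab; rewrite /reflection; set u := a - b; set k := 2 / _.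
rewrite mulmxBl mul1mx -scalemxAl -mulmxA dot_scalar mul_mx_scalar scalerA.
have [u0|u0] := eqVneq (dot u u) 0.
  by have /eqP := dot_eq0 u0; rewrite subr_eq0 => /eqP ->;
    rewrite /k u0 invr0 mulr0 mul0r scale0r subr0.
suff -> : k * dot u a = 1 by rewrite scale1r /u opprB addrC subrK.
have -> : dot u a = 2^-1 * dot u u.
  by rewrite /u !(dotBl, dotBr) -ab (dotC b a); field.
by rewrite /k; field.
Qed.

(** Seen from space, i.e. after conjugation by [g], a skew matrix that annihilates
    [q] has vanishing first row and column; its entries above the diagonal in the
    other rows are the multipliers, and skewness supplies the part below the
    diagonal. *)
Lemma reaction_of_skew g A : is_orthogonal g -> is_skew_mx A ->
  A *m body_axis g 0 = 0 -> exists lam, A = reaction g lam.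
Proof.
move=> og skA Aq; pose Z := g *m A *m g^T; exists Z.
have skZ i j : Z j i = - Z i j.
  have : Z^T = - Z by rewrite /Z !trmx_mul trmxK skA mulNmx mulmxN mulmxA.
  by move/matrixP/(_ i j); rewrite !mxE.
have Z0 i : Z i 0 = 0.
  have : col 0 Z = 0.
    by rewrite colE /Z -!mulmxA -/(axis 0) -body_axis_orthogonal// Aq mulmx0.
  by move/matrixP/(_ i 0); rewrite !mxE.
have AZ : A = g^T *m Z *m g.
  by rewrite /Z !mulmxA og mul1mx -mulmxA og mulmx1.
(* [U] keeps the entries above the diagonal, outside the first row. *)
clearbody Z; pose U := \matrix_(i, j) (if (0 < i < j)%N then Z i j else 0).
have ZU : Z = U - U^T.
  apply/matrixP => i j; rewrite !mxE.
  have [ij|ji|/val_inj ->] := ltngtP i j.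
  - rewrite andbF subr0; have [i0|] := posnP i; last by [].
    rewrite (_ : i = 0); last exact: val_inj.
    by rewrite skZ Z0 oppr0.
  - rewrite andbF sub0r; have [j0|_] := posnP j; last by rewrite skZ.
    rewrite (_ : j = 0); last exact: val_inj.
    by rewrite Z0 oppr0.
  - rewrite andbF subr0; have /eqP := skZ j j.
    by rewrite -addr_eq0 -mulr2n mulrn_eq0 /= => /eqP.
have SZ : Z = \sum_(r < m.+1 | (0 < r)%N) \sum_(s < m.+1 | (r < s)%N)
      Z r s *: wedge (axis r) (axis s).
  rewrite {1}ZU {1 2}(matrix_sum_delta U) raddf_sum -sumrB [RHS]big_mkcond/=.
  apply: eq_bigr => r _; rewrite raddf_sum -sumrB.
  case: posnP => r0.
    by rewrite big1// => s _; rewrite mxE r0 /= scale0r linear0 subrr.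
  rewrite [RHS]big_mkcond/=; apply: eq_bigr => s _.
  rewrite mxE r0 /=; case: ifP => _; last by rewrite scale0r linear0 subrr.
  by rewrite linearZ /= trmx_delta -scalerBr /wedge !trmx_delta !mul_delta_mx.
rewrite AZ {1}SZ /reaction mulmx_sumr mulmx_suml; apply: eq_bigr => r _.
rewrite mulmx_sumr mulmx_suml; apply: eq_bigr => s _.
rewrite -scalemxAr -scalemxAl !body_axis_orthogonal//.
by rewrite wedge_conj trmxK.
Qed.

Lemma reaction_body_axis g lam :
  is_orthogonal g -> reaction g lam *m body_axis g 0 = 0.
Proof.
move=> og; rewrite /reaction mulmx_suml big1// => r r0.
rewrite mulmx_suml big1// => s rs.
rewrite -scalemxAl wedge_mulmx !dot_body_axis//.
rewrite -!val_eqE /= gtn_eqF ?(gtn_eqF r0) ?(leq_trans _ rs)//.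
by rewrite !scale0r subrr scaler0.
Qed.

End LinearAlgebra.

(** * Derivatives of matrix-valued curves *)

Section MatrixCalculus.
Context {R : realType}.

Lemma is_derive_mxP (m n : nat) (t : R)
    (M : R -> 'M[R]_(m, n)) (M' : 'M[R]_(m, n)) :
  is_derive t 1 M M' <->
  forall i j, is_derive t 1 (fun s => M s i j) (M' i j).
Proof.
split=> [[dM <-] i j|dM].
  have /derivable_mxP/(_ i j) dMij := dM.
  by split=> //; rewrite (derive_mx dM) mxE.
have dM0 : derivable M t 1 by apply/derivable_mxP => i j; case: (dM i j).
split=> //; rewrite (derive_mx dM0); apply/matrixP => i j; rewrite mxE.
by case: (dM i j).
Qed.

Lemma is_derive_mulmx (m n k : nat) (t : R)
    (A : R -> 'M[R]_(m, n)) (A' : 'M[R]_(m, n))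
    (B : R -> 'M[R]_(n, k)) (B' : 'M[R]_(n, k)) :
  is_derive t 1 A A' -> is_derive t 1 B B' ->
  is_derive t 1 (fun s => A s *m B s) (A' *m B t + A t *m B').
Proof.
move=> /is_derive_mxP dA /is_derive_mxP dB; apply/is_derive_mxP => i j.
have := is_derive_sum (fun l => is_deriveM (dA i l) (dB l j)).
rewrite fct_sumE => dAB.
under eq_fun do rewrite mxE.
suff -> : (A' *m B t + A t *m B') i j =
  \sum_l (A t i l *: B' l j + B t l j *: A' i l) by exact: dAB.
rewrite !mxE -big_split; apply: eq_bigr => l _ /=.
by rewrite addrC; congr (_ + _); exact: mulrC.
Qed.

Lemma is_derive_trmx (m n : nat) (t : R)
    (A : R -> 'M[R]_(m, n)) (A' : 'M[R]_(m, n)) :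
  is_derive t 1 A A' -> is_derive t 1 (fun s => (A s)^T) A'^T.
Proof.
move=> /is_derive_mxP dA; apply/is_derive_mxP => i j; rewrite mxE.
by under eq_fun do rewrite mxE.
Qed.

Lemma derivable_mulmx (m n k : nat) (t : R)
    (A : R -> 'M[R]_(m, n)) (B : R -> 'M[R]_(n, k)) :
  derivable A t 1 -> derivable B t 1 -> derivable (fun s => A s *m B s) t 1.
Proof. by move=> /derivableP dA /derivableP dB; case: (is_derive_mulmx dA dB). Qed.

Lemma derivable_trmx (m n : nat) (t : R) (A : R -> 'M[R]_(m, n)) :
  derivable A t 1 -> derivable (fun s => (A s)^T) t 1.
Proof. by move=> /derivableP dA; case: (is_derive_trmx dA). Qed.

Lemma derivable_dot m (t : R) (a b : R -> 'cV[R]_m.+1) :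
  derivable a t 1 -> derivable b t 1 -> derivable (fun s => dot (a s) (b s)) t 1.
Proof.
move=> da db.
by have /derivable_mxP := derivable_mulmx (derivable_trmx da) db; exact.
Qed.

Lemma derivable_scalemx (m n : nat) (t : R) (f : R -> R) (A : R -> 'M[R]_(m, n)) :
  derivable f t 1 -> derivable A t 1 -> derivable (fun s => f s *: A s) t 1.
Proof.
move=> df /derivable_mxP dA; apply/derivable_mxP => i j.
under eq_fun do rewrite mxE.
exact: (derivableM df (dA i j)).
Qed.

Lemma derivable_wedge m (t : R) (a b : R -> 'cV[R]_m.+1) :
  derivable a t 1 -> derivable b t 1 -> derivable (fun s => wedge (a s) (b s)) t 1.
Proof.
move=> da db; exact: (derivableB (derivable_mulmx da (derivable_trmx db))
  (derivable_mulmx db (derivable_trmx da))).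
Qed.
End MatrixCalculus.

(** * Reduction of the phase space *)

Section Reduction.
Context {R : realType} {m : nat} (J : 'rV[R]_m.+1).
Implicit Types (q w p : 'cV[R]_m.+1) (A g Om h : 'M[R]_m.+1).

Local Notation D := (diag_mx J).

Lemma inertia_skew A : is_skew_mx A -> is_skew_mx (inertia J A).
Proof.
move=> skA; rewrite /is_skew_mx /inertia linearD /= !trmx_mul tr_diag_mx skA.
by rewrite mulNmx mulmxN opprD addrC.
Qed.

(** The Legendre transform: the momentum [p = - I(Om) q] in terms of the velocity
    [w] when [Om = q /\ w]. *)
Lemma inertia_wedge q w : dot q q = 1 -> dot q w = 0 ->
  - (inertia J (wedge q w) *m q) = Cmx_inv J q *m w - dot w (D *m q) *: q.
Proof.
move=> q1 qw0; rewrite /inertia /Cmx_inv (mulmxDl _ _ q) (mulmxDl _ _ w).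
rewrite mul_scalar_mx.
rewrite -!mulmxA !wedge_mulmx (dotC w q) q1 qw0 scale0r scale1r sub0r mulmxN.
by rewrite opprD opprK opprB addrA.
Qed.

(** The Legendre pairing of the momentum with the velocity. *)
Lemma hamiltonianE q p : hamiltonian J q p = 2^-1 * dot p (qdot J q p).
Proof.
rewrite /hamiltonian /qdot mulmxBr -scalemxAr dotBr dotZr.
by rewrite expr2 mulrAC.
Qed.

(** The vector [v] in the definition of the phase space matters only modulo [q];
    [- Om q] is its component orthogonal to [q]. *)
Lemma phase_spaceP g Om : phase_space g Om ->
  let q := proj_q g Om in let w := - (Om *m q) in
  [/\ dot q q = 1, dot q w = 0 & Om = wedge q w].
Proof.
move=> [og skOm [v Omv]] q w.
have q1 : dot q q = 1 by rewrite dot_body_axis// eqxx.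
have Omq : w = v - dot v q *: q.
  by rewrite /w Omv wedge_mulmx -/(proj_q g Om) -/q q1 scale1r opprB.
split => //; first by rewrite dotNr dot_skew// oppr0.
rewrite Omq {1}Omv -/(proj_q g Om) -/q /wedge.
rewrite linearB /= linearZ /= mulmxBr mulmxBl -scalemxAl -scalemxAr.
by rewrite opprB addrA subrK.
Qed.

Section Positive.
Hypothesis J_gt0 : forall i, 0 < J 0 i.

Lemma dot_diag_ge0 q : 0 <= dot q (D *m q).
Proof.
rewrite dotE sumr_ge0// => i _; rewrite mul_diag_mx mxE mulrCA -expr2.
by rewrite mulr_ge0 ?sqr_ge0// ltW.
Qed.

Lemma Cmx_inv_diagE q :
  Cmx_inv J q = diag_mx (\row_i (J 0 i + dot q (D *m q))).
Proof.
rewrite /Cmx_inv -diag_const_mx -linearD /=; congr diag_mx.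
by apply/rowP => i; rewrite !mxE.
Qed.

Lemma Cmx_inv_gt0 q i : 0 < J 0 i + dot q (D *m q).
Proof. by rewrite ltr_pwDl// dot_diag_ge0. Qed.

Lemma Cmx_inv_unit q : Cmx_inv J q \in unitmx.
Proof.
rewrite unitmxE Cmx_inv_diagE det_diag unitfE; apply/prodf_neq0 => i _.
by rewrite mxE gt_eqF// Cmx_inv_gt0.
Qed.

(** The explicit inverse, through which positivity and differentiability of [Cmx]
    reduce to those of scalar functions. *)
Lemma Cmx_diagE q :
  Cmx J q = diag_mx (\row_i (J 0 i + dot q (D *m q))^-1).
Proof.
rewrite /Cmx -[RHS](mulKmx (Cmx_inv_unit q)).
rewrite [X in invmx _ *m X](_ : _ = 1%:M) ?mulmx1//.
rewrite Cmx_inv_diagE mulmx_diag -diag_const_mx; congr diag_mx.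
by apply/rowP => i; rewrite !mxE divff// gt_eqF// Cmx_inv_gt0.
Qed.

Lemma Cmx_sym q : (Cmx J q)^T = Cmx J q.
Proof. by rewrite Cmx_diagE tr_diag_mx. Qed.

Lemma dot_Cmx_gt0 q : dot q q = 1 -> 0 < dot q (Cmx J q *m q).
Proof.
move=> q1; have pos i : 0 <= q i 0 * (Cmx J q *m q) i 0.
  rewrite Cmx_diagE mul_diag_mx !mxE mulrCA -expr2.
  by rewrite mulr_ge0 ?sqr_ge0// invr_ge0 ltW// Cmx_inv_gt0.
rewrite lt_def dotE sumr_ge0// andbT; apply/eqP => /psumr_eq0P z.
have /eqP : q = 0.
  apply/colP => i; rewrite mxE; have /eqP := z (fun i _ => pos i) i isT.
  rewrite Cmx_diagE mul_diag_mx !mxE mulrCA mulf_eq0 invr_eq0.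
  by rewrite gt_eqF ?Cmx_inv_gt0//= mulf_eq0 orbb => /eqP.
apply/negP; apply: contra_eq_neq q1 => ->.
by rewrite /dot mulmx0 mxE eq_sym oner_eq0.
Qed.

(** The symmetry of [C] turns [p . C q] into [q . C p = - (w . D q) (q . C q)], so the
    correction term in [qdot] restores exactly what the [q]-component of the
    momentum removes from [C p]. *)
Lemma qdot_momentum q w : dot q q = 1 -> dot q w = 0 ->
  qdot J q (Cmx_inv J q *m w - dot w (D *m q) *: q) = w.
Proof.
move=> q1 qw0; set p := _ - _.
have Cp : Cmx J q *m p = w - dot w (D *m q) *: (Cmx J q *m q).
  by rewrite /p mulmxBr mulKmx ?Cmx_inv_unit// -scalemxAr.
rewrite /qdot.
have -> : dot p (Cmx J q *m q) = - dot w (D *m q) * dot q (Cmx J q *m q).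
  by rewrite dotC dot_mulmxl Cmx_sym Cp dotBr dotZr qw0 sub0r mulNr.
rewrite mulfK ?gt_eqF ?dot_Cmx_gt0// mulmxBr Cp -scalemxAr scaleNr.
by rewrite opprK subrK.
Qed.

Lemma dot_qdot q p : dot q q = 1 -> dot q (qdot J q p) = 0.
Proof.
move=> q1; rewrite /qdot mulmxBr -scalemxAr dotBr dotZr.
rewrite divfK ?gt_eqF ?dot_Cmx_gt0//.
by rewrite (dotC p) dot_mulmxl Cmx_sym subrr.
Qed.

(** Let [mu] be the coefficient subtracted in [qdot]; then [C^-1 w = p - mu q].  The
    inner product with [q] identifies [mu]: on one side it is [w . D q], on the
    other [- mu], because [q] is orthogonal to both [w] and [p]. *)
Lemma momentum_qdot q p : dot q q = 1 -> dot q p = 0 ->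
  let w := qdot J q p in Cmx_inv J q *m w - dot w (D *m q) *: q = p.
Proof.
move=> q1 qp0 w; have qw0 : dot q w = 0 by exact: dot_qdot.
have Cw : Cmx_inv J q *m w = p - (dot p (Cmx J q *m q) / dot q (Cmx J q *m q)) *: q.
  by rewrite /w /qdot mulKVmx ?Cmx_inv_unit.
have : dot q (Cmx_inv J q *m w) = dot w (D *m q).
  rewrite mulmxDl mul_scalar_mx dotDr dotZr qw0 mulr0 addr0.
  by rewrite (dotC w) dot_mulmxl tr_diag_mx.
rewrite {1}Cw dotBr qp0 dotZr q1 mulr1 sub0r => <-.
by rewrite scaleNr opprK Cw subrK.
Qed.

Lemma phase_space_qdot g Om : phase_space g Om ->
  qdot J (proj_q g Om) (proj_p J g Om) = - (Om *m proj_q g Om).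
Proof.
move=> /phase_spaceP[q1 qw0 OmE].
by rewrite /proj_p {2}OmE -/(proj_q g Om) inertia_wedge// qdot_momentum.
Qed.

Lemma phase_space_cotangent g Om : phase_space g Om ->
  cotangent_sphere (proj_q g Om) (proj_p J g Om).
Proof.
move=> ps; have [q1 _ _] := phase_spaceP ps; have [_ skOm _] := ps.
split; first exact/enorm1.
by rewrite dotNr dot_skew ?oppr0//; exact: inertia_skew.
Qed.

Lemma hamiltonian_energy g Om : phase_space g Om ->
  hamiltonian J (proj_q g Om) (proj_p J g Om) = energy J Om.
Proof.
move=> ps; have [_ _ OmE] := phase_spaceP ps; have [_ skOm _] := ps.
rewrite hamiltonianE phase_space_qdot// /energy [X in pairing _ X]OmE.
rewrite pairing_skew_wedge; last exact: inertia_skew.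
by rewrite /proj_p dotNl.
Qed.

(** Any orthogonal matrix carrying [q] to the first axis serves as [g], and the
    velocity [qdot J q p] determines the only possible [Om]. *)
Lemma projection_surjective q p : cotangent_sphere q p ->
  exists g Om, [/\ phase_space g Om, proj_q g Om = q & proj_p J g Om = p].
Proof.
move=> [/enorm1 q1 qp0]; pose g := reflection (q - axis 0).
have og : is_orthogonal g by exact: reflection_orthogonal.
have gq : g *m q = axis 0 by rewrite reflection_sub// q1 dot_axis eqxx.
have qE Om : proj_q g Om = q.
  by rewrite /proj_q body_axis_orthogonal// -gq mulmxA og mul1mx.
pose Om := wedge q (qdot J q p); exists g, Om; split => //.
- split=> //; first exact: wedge_skew.
  by exists (qdot J q p); rewrite -/(proj_q g Om) qE.
- rewrite /proj_p -/(proj_q g Om) qE inertia_wedge ?dot_qdot//.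
  exact: momentum_qdot.
Qed.

(** Equal [(q, p)] give equal [w], hence equal [Om]; the connecting element is
    [g' g^T], which fixes the first axis because [g] and [g'] have the same [q]. *)
Lemma projection_fibres g Om g' Om' : phase_space g Om -> phase_space g' Om' ->
  (proj_q g Om = proj_q g' Om' /\ proj_p J g Om = proj_p J g' Om') <->
  (exists A, [/\ GL A, g' = A *m g & Om' = Om]).
Proof.
move=> ps ps'; have [og _ _] := ps; have [og' _ _] := ps'; split.
- move=> [qq pp].
  have [_ _ OmE] := phase_spaceP ps; have [_ _ OmE'] := phase_spaceP ps'.
  exists (g' *m g^T); split; last 1 first.
  + by rewrite OmE' OmE -!phase_space_qdot// qq pp.
  + split.
      rewrite /is_orthogonal trmx_mul trmxK -mulmxA (mulmxA g'^T) og' mul1mx.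
      exact: orthogonal_mulmxT.
    rewrite -mulmxA -body_axis_orthogonal// -/(proj_q g Om) qq.
    by rewrite /proj_q body_axis_orthogonal// mulmxA orthogonal_mulmxT ?mul1mx.
  + by rewrite -mulmxA og mulmx1.
- move=> [A [[oA A0] -> ->]].
  have qq : body_axis (A *m g) 0 = body_axis g 0.
    rewrite !body_axis_orthogonal//; last first.
      by rewrite /is_orthogonal trmx_mul -mulmxA (mulmxA A^T) oA mul1mx.
    by rewrite trmx_mul -mulmxA -{1}A0 (mulmxA A^T) oA mul1mx.
  by rewrite /proj_q /proj_p qq.
Qed.

Lemma GR_commutes h : GR J h -> h *m D = D *m h.
Proof.
by move=> [oh hD]; have [_ uh] := mulmx1_unit oh; rewrite -{2}hD mulmxKV.
Qed.

Lemma GR_Cmx h q : GR J h ->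
  Cmx J (h *m q) = Cmx J q /\ h *m Cmx J q = Cmx J q *m h.
Proof.
move=> Gh; have [oh _] := Gh; have hD := GR_commutes Gh.
have hC : h *m Cmx_inv J q = Cmx_inv J q *m h.
  by rewrite /Cmx_inv mulmxDr mulmxDl hD scalar_mxC.
split.
  by rewrite /Cmx /Cmx_inv mulmxA -hD -mulmxA dot_orthogonal.
have uC := Cmx_inv_unit q.
by rewrite -[LHS](mulKmx uC) (mulmxA _ h) -hC -(mulmxA h) mulmxV// mulmx1.
Qed.

Lemma GR_invariant h q p : GR J h -> cotangent_sphere q p ->
  [/\ cotangent_sphere (h *m q) (h *m p),
      qdot J (h *m q) (h *m p) = h *m qdot J q p &
      pdot J (h *m q) (h *m p) = h *m pdot J q p].
Proof.
move=> Gh [q1 qp0]; have [oh _] := Gh; have [Ch hC] := GR_Cmx q Gh.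
have qh : qdot J (h *m q) (h *m p) = h *m qdot J q p.
  rewrite /qdot Ch !mulmxA -hC -!mulmxA !dot_orthogonal// !mulmxA hC -!mulmxA.
  by congr (_ *m _); rewrite mulmxBr -scalemxAr.
split => //; first by split; rewrite /enorm dot_orthogonal.
by rewrite /pdot -scalemxAr !hamiltonianE qh dot_orthogonal.
Qed.

End Positive.
End Reduction.

(** * Reduction of the dynamics *)

Section Dynamics.
Context {R : realType} {m : nat} (J : 'rV[R]_m.+1).
Hypothesis J_gt0 : forall i, 0 < J 0 i.

Lemma is_derive_inertia (t : R) (Om : R -> 'M[R]_m.+1) (Om' : 'M[R]_m.+1) :
  is_derive t 1 Om Om' -> is_derive t 1 (fun s => inertia J (Om s)) (inertia J Om').
Proof.
move=> dOm; rewrite /inertia.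
have dD : is_derive t 1 (fun _ : R => diag_mx J) 0 by exact: is_derive_cst.
have := is_deriveD (is_derive_mulmx dD dOm) (is_derive_mulmx dOm dD).
by rewrite mul0mx mulmx0 add0r addr0.
Qed.

Lemma derivable_Cmx (t : R) (q : R -> 'cV[R]_m.+1) :
  derivable q t 1 -> derivable (fun s => Cmx J (q s)) t 1.
Proof.
move=> dq; under eq_fun do rewrite Cmx_diagE//.
apply/derivable_mxP => i j; under eq_fun do rewrite !mxE.
case: (i == j); last exact: derivable_cst.
apply: derivableV; first by rewrite gt_eqF// Cmx_inv_gt0.
apply: derivableD; first exact: derivable_cst.
have dD : derivable (fun _ : R => diag_mx J) t 1 by exact: derivable_cst.
exact: (derivable_dot dq (derivable_mulmx dD dq)).
Qed.

(** The second-order information of the problem: along a reduced solution the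
    velocity [w] is again differentiable, although only [q] and [p] are given as
    differentiable curves. *)
Lemma derivable_qdot (t : R) (q p : R -> 'cV[R]_m.+1) : dot (q t) (q t) = 1 ->
  derivable q t 1 -> derivable p t 1 ->
  derivable (fun s => qdot J (q s) (p s)) t 1.
Proof.
move=> q1 dq dp; have dC := derivable_Cmx dq.
have dCq := derivable_mulmx dC dq.
have dV := @derivableV _ _ (fun s => dot (q s) (Cmx J (q s) *m q s)) t 1
  (lt0r_neq0 (dot_Cmx_gt0 J_gt0 q1)) (derivable_dot dq dCq).
have dmu := derivableM (derivable_dot dp dCq) dV.
exact: (derivable_mulmx dC (derivableB dp (derivable_scalemx dmu dq))).
Qed.

Variables (I : set R) (g Om : R -> 'M[R]_m.+1).
Hypotheses (oI : open I) (kin : kinematic_curve I g Om).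

Let near_I t : I t -> \near t, I t.
Proof. by move=> It; exact: open_nbhs_nbhs. Qed.

(** [(g Om)^T e_1 = Om^T q = - Om q].  The orthogonality of [g] near [t] is used to
    replace the inverse of [g] by its transpose before differentiating. *)
Lemma is_derive_proj_q t : I t ->
  is_derive t 1 (fun s => proj_q (g s) (Om s)) (- (Om t *m proj_q (g t) (Om t))).
Proof.
move=> It; have [[og skOm _] dg] := kin It.
apply: (@near_eq_is_derive _ _ _ (fun s => (g s)^T *m axis 0)).
  apply: filterS (near_I It) => s /kin[[ogs _ _] _].
  by rewrite /proj_q body_axis_orthogonal.
have := is_derive_mulmx (is_derive_trmx dg) (is_derive_cst (axis 0) t 1).
rewrite mulmx0 addr0 trmx_mul skOm -mulmxA.
by rewrite -body_axis_orthogonal// mulNmx.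
Qed.

(** The momentum balance for an arbitrary derivative [X] of the inertia: [p] obeys
    the reduced equation up to the action on [q] of the defect [X - [M, Om]] in the
    Euler equations. *)
Lemma is_derive_proj_p t X : I t ->
  is_derive t 1 (fun s => inertia J (Om s)) X ->
  is_derive t 1 (fun s => proj_p J (g s) (Om s))
    (pdot J (proj_q (g t) (Om t)) (proj_p J (g t) (Om t))
     - (X - commutator (inertia J (Om t)) (Om t)) *m proj_q (g t) (Om t)).
Proof.
move=> It dX; have [ps _] := kin It.
have [q1 qw0 OmE] := phase_spaceP ps; have [_ skOm _] := ps.
have := is_deriveN (is_derive_mulmx dX (is_derive_proj_q It)).
set q := proj_q _ _; set p := proj_p _ _ _; set M := inertia J (Om t).
suff <- : - (X *m q + M *m - (Om t *m q)) =
  pdot J q p - (X - commutator M (Om t)) *m q by [].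
have qp0 : dot q p = 0 by case: (phase_space_cotangent J ps).
have -> : pdot J q p = Om t *m M *m q.
  rewrite -mulmxA -[M *m q]opprK mulmxN -/(proj_p J (g t) (Om t)) -/p.
  rewrite /pdot hamiltonianE (phase_space_qdot J_gt0 ps) {3}OmE.
  rewrite wedge_mulmx qp0 scale0r subr0 (dotC p) -scaleNr -/q.
  by rewrite mulNr mulrA mulfV ?pnatr_eq0// mul1r.
rewrite /commutator !mulmxBl mulmxN opprD opprK !mulmxA.
by apply/matrixP => i j; rewrite !mxE; ring.
Qed.

Lemma reduced_of_veselova : veselova_solution J I g Om ->
  reduced_solution J I (fun t => proj_q (g t) (Om t))
                       (fun t => proj_p J (g t) (Om t)).
Proof.
move=> [_ dyn] t It; have [ps _] := kin It; have [og _ _] := ps; split.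
- exact: phase_space_cotangent.
- by rewrite phase_space_qdot//; exact: is_derive_proj_q.
- have [lam dM] := dyn t It.
  have := is_derive_proj_p It dM.
  by rewrite [X in X *m _]addrAC subrr add0r reaction_body_axis// subr0.
Qed.

(** Both [Om] and its transpose are differentiated to see that the derivative of
    [Om] is skew, so that the defect in the Euler equations is skew as well. *)
Lemma veselova_of_reduced :
  reduced_solution J I (fun t => proj_q (g t) (Om t))
                       (fun t => proj_p J (g t) (Om t)) ->
  veselova_solution J I g Om.
Proof.
move=> red; split=> // t It; have [_ dq dp] := red t It.
have [ps _] := kin It; have [og skOm _] := ps; have [q1 _ _] := phase_spaceP ps.
have OmE s : I s ->
    wedge (proj_q (g s) (Om s))
      (qdot J (proj_q (g s) (Om s)) (proj_p J (g s) (Om s)))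
    = Om s.
  move=> /kin[pss _]; have [_ _ OmsE] := phase_spaceP pss.
  by rewrite phase_space_qdot// -OmsE.
have /derivableP dOm : derivable Om t 1.
  have [dq0 _] := dq; have [dp0 _] := dp.
  apply: near_eq_derivable (derivable_wedge dq0 (derivable_qdot q1 dq0 dp0)).
  exact: filterS OmE (near_I It).
set Om' := 'D_1 Om t in dOm.
have skOm' : is_skew_mx Om'.
  have dT : is_derive t 1 (fun s => - Om s) Om'^T.
    apply: near_eq_is_derive (is_derive_trmx dOm).
    by apply: filterS (near_I It) => s /kin[[_ ? _] _].
  by rewrite /is_skew_mx -(@derive_val _ _ _ _ _ _ _ dT)
    (@derive_val _ _ _ _ _ _ _ (is_deriveN dOm)).
have dM := is_derive_inertia dOm.
pose Y := inertia J Om' - commutator (inertia J (Om t)) (Om t).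
have skY : is_skew_mx Y.
  rewrite /is_skew_mx /Y [LHS]linearB /= inertia_skew//.
  rewrite (commutator_skew (inertia_skew J skOm) skOm).
  by rewrite opprK opprB addrC.
have Yq : Y *m proj_q (g t) (Om t) = 0.
  have := @derive_val _ _ _ _ _ _ _ (is_derive_proj_p It dM).
  rewrite (@derive_val _ _ _ _ _ _ _ dp) => /eqP.
  by rewrite -subr_eq0 opprB addrC subrK => /eqP.
have [lam YE] := reaction_of_skew og skY Yq.
by exists lam; rewrite -YE addrC subrK.
Qed.

End Dynamics.

Theorem proposition3p4 (R : realType) (n : nat) (J : 'rV[R]_n.+2)
    (J_gt0 : forall i, 0 < J 0 i) :
  [/\ (* the formulas make sense on T^*S^{n-1} *)
      forall q : 'cV[R]_n.+2, enorm q = 1 ->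
        Cmx_inv J q \in unitmx /\ dot q (Cmx J q *m q) != 0,
      induces_identification J,
      (* reduced equations of motion *)
      (forall (I : set R) (g Om : R -> 'M[R]_n.+2),
         open I -> is_interval I -> veselova_solution J I g Om ->
         reduced_solution J I (fun t => proj_q (g t) (Om t))
                              (fun t => proj_p J (g t) (Om t))) /\
      (forall (I : set R) (g Om : R -> 'M[R]_n.+2),
         open I -> is_interval I -> kinematic_curve I g Om ->
         reduced_solution J I (fun t => proj_q (g t) (Om t))
                              (fun t => proj_p J (g t) (Om t)) ->
         veselova_solution J I g Om),
      (* energy integral *)
      forall g Om : 'M[R]_n.+2, phase_space g Om ->
        hamiltonian J (proj_q g Om) (proj_p J g Om) = energy J Om &
      (* invariance under G_R *)
      forall (h : 'M[R]_n.+2) (q p : 'cV[R]_n.+2),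
        GR J h -> cotangent_sphere q p ->
        [/\ cotangent_sphere (h *m q) (h *m p),
            qdot J (h *m q) (h *m p) = h *m qdot J q p &
            pdot J (h *m q) (h *m p) = h *m pdot J q p]].
Proof.
split.
- move=> q /enorm1 q1; split; first exact: Cmx_inv_unit.
  by rewrite gt_eqF// dot_Cmx_gt0.
- split; [exact: phase_space_cotangent|exact: projection_surjective|].
  exact: projection_fibres.
- split=> I g Om oI _.
    by move=> sol; have [kin _] := sol; exact: reduced_of_veselova.
  exact: veselova_of_reduced.
- exact: hamiltonian_energy.
- exact: GR_invariant.
Qed.
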